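(* Let $(X,T)$ be a topological dynamical system and let $\mathcal{F}=\{f_n\}_{n\ge1}$ and $\Phi=\{\varphi_n\}_{n\ge1}$ be two asymptotically additive potentials on $X$. Let $\mu^*\in\mathcal{E}_T$ be any ergodic measure with $\mathcal{F}_*(\mu^* )=\beta(\mathcal{F})$ (such a measure exists) and set $\alpha^*=\Phi_*(\mu^* )$. Then $\Lambda_{\mathcal{F}\mid\Phi}$ is monotone nondecreasing on $[\eta(\Phi),\alpha^*]$ and monotone nonincreasing on $[\alpha^*,\beta(\Phi)]$.
   Context: $X$ is a compact metric space and $T:X\to X$ is continuous. $\mathcal{M}_T$ denotes the set of $T$-invariant Borel probability measures on $X$ (with the weak$^*$ topology) and $\mathcal{E}_T$ the set of ergodic ones. For $f\in C(X)$, $S_nf=\sum_{i=0}^{n-1}f\circ T^i$. A sequence $\mathcal{F}=\{f_n\}_{n\ge1}\subset C(X)$ is an asymptotically additive potential (AAP) if for every $\xi>0$ there is $f_\xi\in C(X)$ with $\limsup_{n\to\infty}\frac1n\|f_n-S_nf_\xi\|_\infty<\xi$. For $\mu\in\mathcal{M}_T$ the limit $\mathcal{F}_*(\mu)=\lim_{n\to\infty}\frac1n\int f_n\,d\mu$ exists and is finite, and $\mu\mapsto\mathcal{F}_*(\mu)$ is continuous and affine on $\mathcal{M}_T$. Define $\beta(\mathcal{F})=\max\{\mathcal{F}_*(\mu):\mu\in\mathcal{M}_T\}$, $\eta(\Phi)=\min\{\Phi_*(\mu):\mu\in\mathcal{M}_T\}$, $\mathcal{M}_T(\Phi,\alpha)=\{\mu\in\mathcal{M}_T:\Phi_*(\mu)=\alpha\}$,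 and $\Lambda_{\mathcal{F}\mid\Phi}(\alpha)=\sup\{\mathcal{F}_*(\mu):\mu\in\mathcal{M}_T(\Phi,\alpha)\}$. *)

(* Defs.v *)
From HB Require Import structures.
From mathcomp Require Import all_boot all_order all_algebra.
From mathcomp Require Import all_classical all_reals all_analysis.
Set Implicit Arguments. Unset Strict Implicit. Unset Printing Implicit Defensive.
Import Order.TTheory GRing.Theory Num.Theory.
Import numFieldNormedType.Exports.
Local Open Scope classical_set_scope.
Local Open Scope ring_scope.

Notation borel X := (g_sigma_algebraType (@open X)).
(* X is pointed (nonempty), as needed for the Borel structure *)

Section Defs.
Context {R : realType} {X : pseudoPMetricType R}.

Notation Prob := (probability (borel X) R).

Definition invariant (T : X -> X) (mu : Prob) : Prop :=
  forall A : set (borel X), measurable A -> mu (T @^-1` A) = mu A.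

Definition ergodic (T : X -> X) (mu : Prob) : Prop :=
  invariant T mu /\
  forall A : set (borel X), measurable A -> T @^-1` A = A ->
    mu A = 0%E \/ mu A = 1%E.

Definition birkhoff (T : X -> X) (n : nat) (f : X -> R) : X -> R :=
  fun x => \sum_(i < n) f (iter i T x).

Definition supnorm (g : X -> R) : R := sup (range (fun x => `|g x|)).

(* asymptotically additive potential; the sequence is indexed by nat, the
   term of index 0 being irrelevant (the paper indexes from n >= 1) *)
Definition AAP (T : X -> X) (fs : nat -> X -> R) : Prop :=
  (forall n, continuous (fs n)) /\
  forall xi : R, 0 < xi -> exists g : X -> R, continuous g /\
    (limn_esup (fun n : nat =>
       ((n%:R)^-1 * supnorm (fun x => fs n x - birkhoff T n g x))%:E)
     < xi%:E)%E.

Definition Fstar (fs : nat -> X -> R) (mu : Prob) : R :=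
  limn (fun n : nat => (n%:R)^-1 * fine (\int[mu]_x (fs n x)%:E)%E).

Definition betaF (T : X -> X) (fs : nat -> X -> R) : R :=
  sup [set Fstar fs mu | mu in [set mu : Prob | invariant T mu]].

Definition etaF (T : X -> X) (fs : nat -> X -> R) : R :=
  inf [set Fstar fs mu | mu in [set mu : Prob | invariant T mu]].

Definition LambdaF (T : X -> X) (fs phis : nat -> X -> R) (alpha : R) : R :=
  sup [set Fstar fs mu |
       mu in [set mu : Prob | invariant T mu /\ Fstar phis mu = alpha]].

End Defs.

(* Main.v *)
(* An invariant measure is encoded by its state g |-> \int g dmu, a normalized
   positive linear functional on C(X); conversely every invariant state comes
   from an invariant measure by the Riesz representation theorem.  The invariant
   states form a compact convex set for pointwise convergence, nonempty because
   it contains the limits of Birkhoff averages along an ultrafilter, and the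
   asymptotic average of an AAP is a uniform limit of evaluations L |-> L g,
   hence continuous and affine on it.

   The states maximizing F_* form a closed face.  A minimal closed face inside
   it is a single point, since maximizing any evaluation would cut it further.
   That point is an extreme invariant state, and so it is ergodic: an invariant
   set A of measure strictly between 0 and 1 would write it as a proper convex
   combination of the conditional expectations given A and its complement.

   For the monotonicity, join a measure at level a to mu^* by a segment: Phi_*
   takes on it every value between a and alpha^*, and F_* does not decrease
   towards mu^*. *)

Require Import Defs.
From HB Require Import structures.
From mathcomp Require Import all_boot all_order all_algebra.
From mathcomp Require Import all_classical all_reals all_analysis.
From mathcomp Require Import measurable_realfun ring.
Import Order.TTheory GRing.Theory Num.Theory.
Import numFieldNormedType.Exports.
Local Open Scope classical_set_scope.
Local Open Scope ring_scope.

Set Implicit Arguments. Unset Strict Implicit. Unset Printing Implicit Defensive.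

(** * Continuous approximation of open sets *)

Section OpenApproximation.
Context {R : realType} {X : pseudoMetricType R}.
Implicit Types (U : set X).

(* The radius 0 is added by hand: `ball x 0` need not be contained in U. *)
Definition inner_radii U (x : X) : set R :=
  [set r | r = 0 \/ 0 < r <= 1 /\ ball x r `<=` U].

(** A stand-in for the distance from [x] to the complement of [U]. The radii are capped at 1 so that
    the supremum is finite even when [U] is the whole space. *)
Definition inner_radius U (x : X) : R := sup (inner_radii U x).

Lemma inner_radii0 U x : inner_radii U x 0.
Proof. by left. Qed.

Lemma has_sup_inner_radii U x : has_sup (inner_radii U x).
Proof.
split; first by exists 0; left.
by exists 1 => r [->//|[/andP[_ ->]]].
Qed.

Lemma inner_radius_ge U x r : inner_radii U x r -> r <= inner_radius U x.
Proof. by apply: ub_le_sup; case: (has_sup_inner_radii U x). Qed.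

Lemma inner_radius_ge0 U x : 0 <= inner_radius U x.
Proof. exact/inner_radius_ge/inner_radii0. Qed.

Lemma inner_radius_out U x : ~ U x -> inner_radius U x = 0.
Proof.
move=> Ux; apply/eqP; rewrite eq_le inner_radius_ge0 andbT.
apply: ge_sup; first by exists 0; left.
move=> r [->//|[/andP[r0 _] rU]].
by exfalso; apply: Ux; apply: rU; exact: ballxx.
Qed.

Lemma inner_radius_gt0 U x : open U -> U x -> 0 < inner_radius U x.
Proof.
move=> oU Ux.
have /nbhs_ballP[e /= e0 eU] : nbhs x U by exact: open_nbhs_nbhs.
apply: (@lt_le_trans _ _ (Num.min e 1)); first by rewrite lt_min e0 ltr01.
apply: inner_radius_ge; right; split.
  by rewrite lt_min e0 ltr01/= ge_min lexx orbT.
by apply: subset_trans eU; apply: le_ball; rewrite ge_min lexx.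
Qed.

(** By the triangle inequality a ball of radius [r > s] about [x] contains the ball of radius
    [r - s] about [y]; for [r <= s] nonnegativity of the inner radius suffices. *)
Lemma inner_radius_lip U x y s : 0 < s ->
  ball x s y -> inner_radius U x - s <= inner_radius U y.
Proof.
move=> s0 xy; rewrite lerBlDr; apply: ge_sup; first by exists 0; left.
move=> r rx; rewrite -lerBlDr; have [rs|sr] := leP r s.
  by rewrite (le_trans _ (inner_radius_ge0 _ _))// subr_le0.
apply: inner_radius_ge; right.
case: rx => [r0|[/andP[r0 r1] rU]].
  by rewrite r0 ltNge (ltW s0) in sr.
split; first by rewrite subr_gt0 sr/= lerBlDr (le_trans r1)// lerDl ltW.
move=> z yz; apply: rU; rewrite -(subrK s r) addrC.
exact: ball_triangle yz.
Qed.

Lemma inner_radius_continuous U : continuous (inner_radius U).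
Proof.
move=> x; apply/cvgrPdist_le => e e0; near=> y.
have xy : ball x e y by near: y; exact: nbhsx_ballx.
rewrite ler_distlC; apply/andP; split; first exact: inner_radius_lip.
by rewrite -lerBlDr; apply: inner_radius_lip => //; exact: ball_sym.
Unshelve. all: by end_near. Qed.

(** Urysohn-type functions: continuous, increasing in [k], and at each point eventually equal to the
    indicator when [U] is open. *)
Definition indic_approx U (k : nat) (x : X) : R := Num.min 1 (k%:R * inner_radius U x).

Lemma indic_approx_continuous U k : continuous (indic_approx U k).
Proof.
move=> x.
apply: (@continuous_min R X (cst 1) (fun y => k%:R * inner_radius U y)).
  exact: cvg_cst.
by apply: cvgM; [exact: cvg_cst|exact: inner_radius_continuous].
Qed.

Lemma indic_approx_ge0 U k x : 0 <= indic_approx U k x.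
Proof. by rewrite le_min ler01 mulr_ge0// inner_radius_ge0. Qed.

Lemma indic_approx_le1 U k x : indic_approx U k x <= 1.
Proof. by rewrite ge_min lexx. Qed.

Lemma indic_approx_out U k x : ~ U x -> indic_approx U k x = 0.
Proof. by move=> Ux; rewrite /indic_approx inner_radius_out// mulr0 min_r. Qed.

Lemma indic_approx_indic U k x : indic_approx U k x <= \1_U x.
Proof.
rewrite indicE; case: (asboolP (U x)) => Ux.
  by rewrite mem_set// indic_approx_le1.
by rewrite memNset// indic_approx_out.
Qed.

Lemma indic_approx_le U x : {homo (fun k => indic_approx U k x) : k l / (k <= l)%N >-> k <= l}.
Proof.
move=> k l kl; rewrite le_min ge_min lexx/= ge_min ler_wpM2r ?orbT//.
  exact: inner_radius_ge0.
by rewrite ler_nat.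
Qed.

Lemma indic_approx_eq1 U x : open U -> U x -> \forall k \near \oo, indic_approx U k x = 1.
Proof.
move=> oU Ux; have r0 := inner_radius_gt0 oU Ux.
near=> k; rewrite /indic_approx min_l// -ler_pdivrMr// mul1r.
by near: k; exact: nbhs_infty_ger.
Unshelve. all: by end_near. Qed.

Lemma indic_approx_cvg U x : open U -> indic_approx U k x @[k --> \oo] --> (\1_U x : R).
Proof.
move=> oU; case: (asboolP (U x)) => Ux; rewrite indicE.
  rewrite mem_set//; apply: cvg_near_cst; exact: indic_approx_eq1.
rewrite memNset//; apply: cvg_near_cst; apply: nearW => k; exact: indic_approx_out.
Qed.

End OpenApproximation.

(** * States on C(X) *)

Section States.
Context {R : realType} {X : pseudoPMetricType R}.
Implicit Types (L : (X -> R) -> R) (U V : set X) (f g h : X -> R) (a b : R).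

(** The value 0 off C(X) makes a state determined by its restriction to C(X): equality of states is
    plain equality of functions, and states lie in a product of lines. *)
Definition state L : Prop := [/\
  forall g, ~ continuous g -> L g = 0,
  forall a g h, continuous g -> continuous h ->
    L (fun x => a * g x + h x) = a * L g + L h,
  forall g, continuous g -> (forall x, 0 <= g x) -> 0 <= L g &
  L (fun=> 1) = 1].

Lemma continuous_lin a (g h : X -> R) : continuous g -> continuous h ->
  continuous (fun x => a * g x + h x).
Proof.
move=> cg ch x; apply: cvgD; last exact: ch.
by apply: cvgM; [exact: cvg_cst|exact: cg].
Qed.

Lemma continuousDf (g h : X -> R) : continuous g -> continuous h ->
  continuous (fun x => g x + h x).
Proof. by move=> cg ch x; apply: cvgD; [exact: cg|exact: ch]. Qed.

Lemma continuousBf (g h : X -> R) : continuous g -> continuous h ->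
  continuous (fun x => g x - h x).
Proof. by move=> cg ch x; apply: cvgB; [exact: cg|exact: ch]. Qed.

Lemma continuousZf a (g : X -> R) : continuous g -> continuous (fun x => a * g x).
Proof. by move=> cg x; apply: cvgM; [exact: cvg_cst|exact: cg]. Qed.

Lemma continuousCf a : continuous ((fun=> a) : X -> R).
Proof. by move=> x; exact: cvg_cst. Qed.

Lemma continuous_minf (g h : X -> R) : continuous g -> continuous h ->
  continuous (fun x => Num.min (g x) (h x)).
Proof.
move=> cg ch x; apply: (@continuous_min R X g h); [exact: cg|exact: ch].
Qed.

Lemma continuous_maxf (g h : X -> R) : continuous g -> continuous h ->
  continuous (fun x => Num.max (g x) (h x)).
Proof.
move=> cg ch x; apply: (@continuous_max R X g h); [exact: cg|exact: ch].
Qed.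

Lemma continuous_sumf n (gs : nat -> X -> R) : (forall i, continuous (gs i)) ->
  continuous (fun x => \sum_(i < n) gs i x).
Proof.
move=> cg; elim: n => [|n IH].
  rewrite (_ : (fun x => _) = fun=> 0); first exact: continuousCf.
  by apply/funext => x; rewrite big_ord0.
rewrite (_ : (fun x => _) = fun x => \sum_(i < n) gs i x + gs n x).
  exact: continuousDf.
by apply/funext => x; rewrite big_ord_recr.
Qed.

Section StateTheory.
Variable L : (X -> R) -> R.
Hypothesis sL : state L.

Lemma state_lin a g h : continuous g -> continuous h ->
  L (fun x => a * g x + h x) = a * L g + L h.
Proof. by case: sL => _ + _ _; exact. Qed.

Lemma state_ge0 g : continuous g -> (forall x, 0 <= g x) -> 0 <= L g.
Proof. by case: sL => _ _ + _; exact. Qed.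

Lemma state1 : L (fun=> 1) = 1.
Proof. by case: sL. Qed.

Lemma stateD g h : continuous g -> continuous h ->
  L (fun x => g x + h x) = L g + L h.
Proof.
move=> cg ch; rewrite -(mul1r (L g)) -state_lin//; congr L.
by apply/funext => x; rewrite mul1r.
Qed.

Lemma stateB g h : continuous g -> continuous h ->
  L (fun x => g x - h x) = L g - L h.
Proof.
move=> cg ch; rewrite addrC -mulN1r -state_lin//; congr L.
by apply/funext => x; rewrite mulN1r addrC.
Qed.

Lemma state0 : L (fun=> 0) = 0.
Proof.
have -> : (fun=> 0) = (fun x : X => (fun=> 1 : R) x - (fun=> 1) x).
  by apply/funext => x; rewrite subrr.
by rewrite stateB ?subrr//; exact: continuousCf.
Qed.

Lemma stateZ a g : continuous g -> L (fun x => a * g x) = a * L g.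
Proof.
move=> cg; rewrite -(addr0 (a * L g)) -state0 -state_lin//.
  by congr L; apply/funext => x; rewrite addr0.
exact: continuousCf.
Qed.

Lemma state_cst a : L (fun=> a) = a.
Proof.
rewrite -[RHS]mulr1 -state1 -stateZ; last exact: continuousCf.
by congr L; apply/funext => x; rewrite mulr1.
Qed.

Lemma state_le g h : continuous g -> continuous h -> (forall x, g x <= h x) ->
  L g <= L h.
Proof.
move=> cg ch gh; rewrite -subr_ge0 -stateB//; apply: state_ge0.
  exact: continuousBf.
by move=> x; rewrite subr_ge0.
Qed.

Lemma state_sum n (gs : nat -> X -> R) : (forall i, continuous (gs i)) ->
  L (fun x => \sum_(i < n) gs i x) = \sum_(i < n) L (gs i).
Proof.
move=> cg; elim: n => [|n IH].
  by rewrite big_ord0 -[RHS]state0; congr L; apply/funext => x; rewrite big_ord0.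
rewrite big_ord_recr/= -IH -stateD//; last exact: continuous_sumf.
by congr L; apply/funext => x; rewrite big_ord_recr.
Qed.

Lemma state_norm_le g b : continuous g -> (forall x, `|g x| <= b) -> `|L g| <= b.
Proof.
move=> cg gb; rewrite ler_norml; apply/andP; split.
  rewrite -(state_cst (- b)); apply: state_le => //; first exact: continuousCf.
  by move=> x; have := gb x; rewrite ler_norml => /andP[].
rewrite -[leRHS]state_cst; apply: state_le => //; first exact: continuousCf.
by move=> x; have := gb x; rewrite ler_norml => /andP[].
Qed.

End StateTheory.

Definition below U : set (X -> R) :=
  [set f : X -> R | continuous f /\ forall x, 0 <= f x <= \1_U x].

(** The Riesz formula for the measure of an open set, with the bound by the indicator standing for
    the usual condition on supports. *)
Definition inner_val L U : \bar R := ereal_sup [set (L f)%:E | f in below U].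

Lemma below_out U f x : below U f -> ~ U x -> f x = 0.
Proof.
move=> [_ /(_ x)] + Ux; rewrite indicE memNset// => /andP[f0 f1].
by apply/eqP; rewrite eq_le f0 f1.
Qed.

Lemma below_le1 U f x : below U f -> f x <= 1.
Proof.
move=> [_ /(_ x)/andP[_ /le_trans]]; apply; rewrite indicE.
by case: (_ \in _).
Qed.

Lemma belowP U f : continuous f -> (forall x, 0 <= f x <= 1) ->
  (forall x, ~ U x -> f x = 0) -> below U f.
Proof.
move=> cf f01 fU; split=> // x; have /andP[f0 f1] := f01 x.
rewrite f0/= indicE; case: (asboolP (U x)) => Ux.
  by rewrite mem_set.
by rewrite memNset// fU.
Qed.

Lemma below_subset U V : U `<=` V -> below U `<=` below V.
Proof.
move=> UV f Uf; have [cf f01] := Uf; apply: belowP => //.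
  by move=> x; have /andP[-> _] := f01 x; rewrite (below_le1 _ Uf).
by move=> x Vx; apply: (below_out Uf) => /UV.
Qed.

Lemma indic_approx_below U k : below U (indic_approx U k).
Proof.
split; first exact: indic_approx_continuous.
by move=> x; rewrite indic_approx_ge0 indic_approx_indic.
Qed.

Lemma inner_val_ge L U f : below U f -> ((L f)%:E <= inner_val L U)%E.
Proof. by move=> Uf; apply: ereal_sup_ubound; exists f. Qed.

Lemma inner_val_subset L U V : U `<=` V -> (inner_val L U <= inner_val L V)%E.
Proof.
move=> UV; apply: ereal_sup_le => _ [f Uf <-]; exists f => //.
exact: below_subset Uf.
Qed.

End States.

(** * The outer measure of a state *)

Section Riesz.
Context {R : realType} {X : pseudoPMetricType R}.
Hypothesis cX : compact [set: X].
Implicit Types (U V A : set X) (f g h : X -> R).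
Variable L : (X -> R) -> R.
Hypothesis sL : state L.

Lemma inner_val_ge0 U : (0 <= inner_val L U)%E.
Proof.
have <- : (L (fun=> 0))%:E = 0%E by rewrite state0.
apply: inner_val_ge; apply: belowP.
- exact: continuousCf.
- by move=> x; rewrite lexx ler01.
- by [].
Qed.

Lemma below_state_le1 U f : below U f -> L f <= 1.
Proof.
move=> Uf; rewrite -(state1 sL); apply: state_le => //; first by case: Uf.
  exact: continuousCf.
by move=> x; exact: below_le1 Uf.
Qed.

Lemma inner_val_le1 U : (inner_val L U <= 1)%E.
Proof.
apply: ge_ereal_sup => _ [f Uf <-]; rewrite lee_fin; exact: below_state_le1 Uf.
Qed.

Lemma inner_val_fin U : inner_val L U \is a fin_num.
Proof.
rewrite ge0_fin_numE ?inner_val_ge0//.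
by rewrite (le_lt_trans (inner_val_le1 _))// ltry.
Qed.

Lemma inner_val0 : inner_val L set0 = 0%E.
Proof.
apply/eqP; rewrite eq_le inner_val_ge0 andbT.
apply: ge_ereal_sup => _ [f f0 <-]; rewrite lee_fin.
rewrite (_ : f = fun=> 0) ?(state0 sL)//.
by apply/funext => x; rewrite (below_out f0).
Qed.

Lemma inner_valT : inner_val L setT = 1%E.
Proof.
apply/eqP; rewrite eq_le inner_val_le1/=.
have <- : (L (fun=> 1))%:E = 1%E by rewrite state1.
apply: inner_val_ge.
by apply: belowP; [exact: continuousCf|move=> x; rewrite ler01 lexx|move=> x []].
Qed.

(** The number of terms and the sharpness of the approximations grow together, so that a single
    index drives the compactness argument. *)
Lemma indic_approx_sum_le (U : nat -> set X) x :
  {homo (fun N => \sum_(n < N) indic_approx (U n) N x) : k l / (k <= l)%N >-> k <= l}.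
Proof.
move=> k l kl; rewrite -[leRHS](big_mkord xpredT (fun n => indic_approx (U n) l x)).
rewrite (big_cat_nat (leq0n k) kl)//= -[leLHS]addr0 lerD//; last first.
  by apply: sumr_ge0 => i _; exact: indic_approx_ge0.
by rewrite big_mkord; apply: ler_sum => i _; exact: indic_approx_le.
Qed.

(* Dini's theorem: the partial sums increase to a function above f. *)
Lemma below_bigcup_sum (U : nat -> set X) f e : (forall n, open (U n)) ->
  below (\bigcup_n U n) f -> 0 < e ->
  exists N, forall x, f x <= \sum_(n < N) indic_approx (U n) N x + e.
Proof.
move=> oU Uf e0; have [cf f01] := Uf.
(* Compactness in near-covering form: a bound valid near each point from some rank on is valid
   everywhere from a common rank on. *)
have : near_covering [set: X] by apply/compact_near_coveringP.
move=> /(_ nat \oo (fun N x => f x <= \sum_(n < N) indic_approx (U n) N x + e) _).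
case=> [x _|N _ NP]; last first.
  by exists N => x; apply: (NP N) => //=.
have [N0 fN0] : exists N0, f x < \sum_(n < N0) indic_approx (U n) N0 x + e.
  have [[n _ Unx]|Ux] := pselect ((\bigcup_n U n) x); last first.
    by exists 0%N; rewrite big_ord0 add0r (below_out Uf).
  (* The rank [maxn N n.+1] both includes the term of index [n] in the sum and makes it equal to
     1. *)
  have [N _ /(_ (maxn N n.+1))] := indic_approx_eq1 (oU n) Unx.
  rewrite /= leq_maxl => /(_ isT) b1; exists (maxn N n.+1).
  rewrite (le_lt_trans (below_le1 _ Uf))//.
  rewrite (@lt_le_trans _ _ (1 + e)) ?ltrDl// lerD2r.
  rewrite (bigD1 (Ordinal (leq_maxr N n.+1)))//= b1 lerDl.
  by apply: sumr_ge0 => i _; exact: indic_approx_ge0.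
have cg : continuous (fun y => \sum_(n < N0) indic_approx (U n) N0 y + e - f y).
  apply: continuousBf => //; apply: continuousDf; last exact: continuousCf.
  by apply: (continuous_sumf (gs := fun n => indic_approx (U n) N0)) => i;
    exact: indic_approx_continuous.
have pos : \forall y \near x,
    0 < \sum_(n < N0) indic_approx (U n) N0 y + e - f y.
  by apply: (cvgr_gt _ (cg x)); rewrite subr_gt0.
exists ([set y | 0 < \sum_(n < N0) indic_approx (U n) N0 y + e - f y],
        [set N | (N0 <= N)%N]) => /=.
  by split => //; exists N0.
move=> [y N] /= [fy N0N]; rewrite subr_gt0 in fy; apply/ltW/(lt_le_trans fy).
by rewrite lerD2r; exact: indic_approx_sum_le.
Qed.

(** A competitor for the union is dominated by a finite sum of approximations plus [e]; applying [L]
    turns this constant into exactly [e], since [L] is normalized. *)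
Lemma inner_val_bigcup (U : nat -> set X) : (forall n, open (U n)) ->
  (inner_val L (\bigcup_n U n) <= \sum_(n <oo) inner_val L (U n))%E.
Proof.
move=> oU; apply: ge_ereal_sup => _ [f Uf <-].
apply/lee_addgt0Pr => e e0.
have [N fN] := below_bigcup_sum oU Uf e0.
apply: (@le_trans _ _ (\sum_(n < N) (L (indic_approx (U n) N))%:E + e%:E)%E).
  rewrite sumEFin -EFinD lee_fin.
  rewrite -(state_sum sL N (gs := fun n => indic_approx (U n) N)); last first.
    by move=> i; exact: indic_approx_continuous.
  rewrite -[X in _ + X](state_cst sL) -stateD//; last 2 first.
  - by apply: (continuous_sumf (gs := fun n => indic_approx (U n) N)) => i;
      exact: indic_approx_continuous.
  - exact: continuousCf.
  apply: state_le => //; first by case: Uf.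
  apply: continuousDf; last exact: continuousCf.
  by apply: (continuous_sumf (gs := fun n => indic_approx (U n) N)) => i;
    exact: indic_approx_continuous.
rewrite leeD2r//.
apply: (@le_trans _ _ (\sum_(n < N) inner_val L (U n))%E).
  by apply: lee_sum => i _; apply: inner_val_ge; exact: indic_approx_below.
rewrite -(big_mkord xpredT (fun n => inner_val L (U n))).
by apply: nneseries_lim_ge => n _ _; exact: inner_val_ge0.
Qed.

(** Extension to all sets by outer regularity. *)
Definition outer_val A : \bar R :=
  ereal_inf [set inner_val L U | U in [set U | open U /\ A `<=` U]].

Lemma outer_val_le U A : open U -> A `<=` U -> (outer_val A <= inner_val L U)%E.
Proof. by move=> oU AU; apply: ereal_inf_lbound; exists U. Qed.

Lemma outer_val_open U : open U -> outer_val U = inner_val L U.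
Proof.
move=> oU; apply/eqP; rewrite eq_le outer_val_le//=.
by apply: le_ereal_inf_tmp => _ [V [oV UV] <-]; exact: inner_val_subset.
Qed.

Lemma outer_val0 : outer_val set0 = 0%E.
Proof. by rewrite outer_val_open ?inner_val0//; exact: open0. Qed.

Lemma outer_val_ge0 A : (0 <= outer_val A)%E.
Proof.
by apply: le_ereal_inf_tmp => _ [V _ <-]; exact: inner_val_ge0.
Qed.

Lemma outer_val_subset : {homo outer_val : A B / A `<=` B >-> (A <= B)%E}.
Proof.
move=> A B AB; apply: ereal_inf_le_tmp => _ [U [oU BU] <-].
by exists U => //; split=> //; exact: subset_trans BU.
Qed.

Lemma outer_val_fin A : outer_val A \is a fin_num.
Proof.
rewrite ge0_fin_numE ?outer_val_ge0//.
apply: (@le_lt_trans _ _ (inner_val L setT)).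
  by apply: outer_val_le; [exact: openT|].
by rewrite inner_valT ltry.
Qed.

Lemma outer_val_near A e : 0 < e -> exists U,
  [/\ open U, A `<=` U & (inner_val L U <= outer_val A + e%:E)%E].
Proof.
move=> e0; have [_ [U [oU AU] <-] /ltW Ue] :=
  lb_ereal_inf_adherent e0 (outer_val_fin A).
by exists U.
Qed.

Lemma outer_val_sigma_subadditive : sigma_subadditive outer_val.
Proof.
move=> F; apply/lee_addgt0Pr => e e0.
have [U HU] : {U : nat -> set X & forall n, [/\ open (U n), F n `<=` U n &
    (inner_val L (U n) <= outer_val (F n) + (e / (2 ^ n.+1)%:R)%:E)%E]}.
  apply: (@choice _ _ (fun n V => [/\ open V, F n `<=` V &
    (inner_val L V <= outer_val (F n) + (e / (2 ^ n.+1)%:R)%:E)%E])) => n.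
  by apply: outer_val_near; rewrite divr_gt0// ltr0n expn_gt0.
rewrite (le_trans _ (epsilon_trick _ _ (ltW e0)))//; last first.
  by move=> n; exact: outer_val_ge0.
apply: (@le_trans _ _ (inner_val L (\bigcup_n U n))).
  apply: outer_val_le; first by apply: bigcup_open => n _; case: (HU n).
  by apply: subset_bigcup => n _; case: (HU n).
apply: (le_trans (inner_val_bigcup _)); first by move=> n; case: (HU n).
apply: lee_nneseries => [n _ _|n _]; first exact: inner_val_ge0.
by case: (HU n).
Qed.

HB.instance Definition _ := isOuterMeasure.Build R X outer_val
  outer_val0 outer_val_ge0 outer_val_subset outer_val_sigma_subadditive.

(** A competitor [f] for the intersection is cut at height [e]. Its positive excess over [e] and any
    [g] below the set [W] where [f < e] are never both nonzero, so their sum is a competitor for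
    [V]; the cut costs at most [e]. *)
Lemma inner_val_split U V : open U -> open V ->
  (inner_val L (V `&` U) + outer_val (V `&` ~` U) <= inner_val L V)%E.
Proof.
move=> oU oV; rewrite -leeBrDr ?outer_val_fin//.
apply: ge_ereal_sup => _ [f VUf <-].
rewrite leeBrDr ?outer_val_fin//; apply/lee_addgt0Pr => e e0.
have [cf f01] := VUf.
(* [W] is an open set containing the part of [V] outside [U], because [f] vanishes there. *)
pose W := V `&` [set x | f x < e].
have oW : open W.
  by apply: openI => //; apply: open_comp (@open_lt R e) => x _; exact: cf.
have le_W : (outer_val (V `&` ~` U) <= inner_val L W)%E.
  apply: outer_val_le => // x [Vx Ux]; split=> //=.
  by rewrite (below_out VUf)// => -[].
apply: (le_trans (leeD2l _ le_W)).
rewrite addeC -leeBrDr//; apply: ge_ereal_sup => _ [g Wg <-].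
rewrite leeBrDr// -EFinD.
have [cg g01] := Wg.
have cm : continuous (fun x => Num.max (f x - e) 0).
  apply: continuous_maxf; last exact: continuousCf.
  by apply: continuousBf => //; exact: continuousCf.
have m0 x : 0 <= Num.max (f x - e) 0 by rewrite le_max lexx orbT.
have VU x : ~ V x -> f x = 0 by move=> Vx; rewrite (below_out VUf)// => -[].
have Vh : below V (fun x => g x + Num.max (f x - e) 0).
  apply: belowP; first exact: continuousDf.
    move=> x; have /andP[g0 _] := g01 x; rewrite addr_ge0//=.
    have [fe|ef] := leP e (f x).
      rewrite (below_out Wg) ?add0r; last by move=> [_ /=]; rewrite ltNge fe.
      by rewrite max_l ?subr_ge0// lerBlDr (le_trans (below_le1 x VUf))// lerDl ltW.
    by rewrite max_r ?addr0 ?(below_le1 x Wg)// subr_le0 ltW.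
  move=> x Vx; rewrite (below_out Wg) ?add0r; last by case.
  by rewrite VU// sub0r max_r// oppr_le0 ltW.
apply: (@le_trans _ _ ((L (fun x => g x + Num.max (f x - e) 0))%:E + e%:E)%E).
  rewrite -EFinD lee_fin stateD// -addrA lerD2l.
  rewrite -[X in _ + X](state_cst sL) -stateD//; last exact: continuousCf.
  apply: state_le => //; first by apply: continuousDf => //; exact: continuousCf.
  by move=> x; rewrite -lerBlDr le_max lexx.
by rewrite leeD2r//; exact: inner_val_ge.
Qed.

(** The test set [A] is replaced by an open [V] around it of nearly the same outer value, and
    [inner_val_split] cuts [V]. *)
Lemma open_caratheodory U : open U -> outer_val.-caratheodory U.
Proof.
move=> oU; apply: (@le_caratheodory_measurable R X outer_val) => A.
apply/lee_addgt0Pr => e e0.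
have [V [oV AV Ve]] := outer_val_near A e0.
apply: le_trans Ve; apply: le_trans (inner_val_split oU oV).
apply: leeD; last by apply: outer_val_subset; exact: setSI.
rewrite -(outer_val_open (openI oV oU)); apply: outer_val_subset; exact: setSI.
Qed.

(** The Caratheodory-measurable sets form a sigma-algebra that contains the open sets. *)
Lemma borel_caratheodory (A : set (borel X)) :
  measurable A -> outer_val.-caratheodory A.
Proof.
move: A; apply: smallest_sub; last by move=> U; exact: open_caratheodory.
split => [|A|F].
- exact: caratheodory_measurable_set0.
- by rewrite setTD; exact: caratheodory_measurable_setC.
- exact: caratheodory_measurable_bigcup.
Qed.

Definition riesz_measure (A : set (borel X)) : \bar R := outer_val A.

Lemma riesz_measure_semi_sigma_additive : semi_sigma_additive riesz_measure.
Proof.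
move=> F mF tF mUF; apply: (@caratheodory_measure_sigma_additive R X outer_val) => //.
  by move=> n; exact: borel_caratheodory.
exact: borel_caratheodory.
Qed.

HB.instance Definition _ := isMeasure.Build _ _ _ riesz_measure
  outer_val0 outer_val_ge0 riesz_measure_semi_sigma_additive.

Lemma riesz_measureT : riesz_measure setT = 1%E.
Proof. by rewrite /riesz_measure outer_val_open ?inner_valT//; exact: openT. Qed.

HB.instance Definition _ := Measure_isProbability.Build _ _ _ riesz_measure
  riesz_measureT.

Lemma riesz_open : exists mu : probability (borel X) R,
  forall U, open U -> mu U = inner_val L U.
Proof.
exists (riesz_measure : probability (borel X) R) => U oU.
exact: outer_val_open.
Qed.

End Riesz.

(** * Riesz representation *)

Section Mean.
Context {R : realType} {X : pseudoPMetricType R}.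
Hypothesis cX : compact [set: X].
Implicit Types (U V : set X) (f g h : X -> R) (A B C : set (borel X)).
Implicit Types (mu nu : probability (borel X) R).

Lemma continuous_bound g : continuous g -> exists2 M, 0 < M & forall x, `|g x| <= M.
Proof.
move=> cg; have cgX : compact (g @` setT).
  by apply: continuous_compact => //; exact: continuous_subspaceT.
have [M [Mr MP]] := compact_bounded cgX.
exists (`|M| + 1); first by rewrite ltr_wpDl.
move=> x; apply: (MP (`|M| + 1)); last by exists x.
by rewrite (le_lt_trans (ler_norm M))// ltrDl.
Qed.

Lemma continuous_borel_measurable A g :
  continuous g -> measurable_fun A (g : borel X -> R).
Proof.
move=> /continuousP cg; apply: measurable_funTS.
apply: (measurability _ (RGenOpens.measurableE R)) => _ [_ [a [b ->] <-]].
by rewrite setTI; apply: sub_sigma_algebra; exact/cg/interval_open.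
Qed.

Lemma continuous_integrable mu A g : measurable A ->
  continuous g -> mu.-integrable A (EFin \o g).
Proof.
move=> mA cg; apply: measurable_bounded_integrable => //.
- by rewrite (le_lt_trans (probability_le1 mu mA))// ltry.
- exact: continuous_borel_measurable.
- have [M M0 gM] := continuous_bound cg.
  exists M; split; first exact: num_real.
  by move=> N MN x _ /=; rewrite (le_trans (gM x))// ltW.
Qed.

(* Conditional expectation given the event A, set to 0 off C(X) so that the
   functional is determined by its values on C(X). *)
Definition mean mu A g : R :=
  if `[< continuous g >] then (fine (mu A))^-1 * \int[mu]_(x in A) g x else 0.

Lemma meanE mu A g : continuous g ->
  mean mu A g = (fine (mu A))^-1 * \int[mu]_(x in A) g x.
Proof. by move=> cg; rewrite /mean; case: asboolP. Qed.

Lemma meanT mu g : continuous g -> mean mu setT g = fine (\int[mu]_x (g x)%:E)%E.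
Proof. by move=> cg; rewrite meanE// probability_setT/= invr1 mul1r. Qed.

Lemma mean_state mu A : measurable A -> 0 < fine (mu A) -> state (mean mu A).
Proof.
move=> mA A0; split.
- by move=> g cg; rewrite /mean; case: asboolP.
- move=> a g h cg ch; rewrite !meanE//; last exact: continuous_lin.
  rewrite RintegralD//.
  + by rewrite RintegralZl//; [ring|exact: continuous_integrable].
  + by apply: continuous_integrable => //; exact: continuousZf.
  + exact: continuous_integrable.
- move=> g cg g0; rewrite meanE// mulr_ge0// ?invr_ge0 ?(ltW A0)//.
  by apply: Rintegral_ge0 => x _.
- rewrite meanE; last exact: continuousCf.
  by rewrite Rintegral_cst// mul1r mulVf// gt_eqF.
Qed.

(** Dominated convergence with the constant bound 1; it recovers the mass of an open set from
    integrals of continuous functions. *)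
Lemma mean_open_cvg mu A U : measurable A -> open U ->
  mean mu A (indic_approx U k) @[k --> \oo] -->
  (fine (mu A))^-1 * fine (mu (U `&` A)).
Proof.
move=> mA oU; have mU : measurable (U : set (borel X)) by exact: sub_sigma_algebra.
rewrite (_ : (fun k => _) = fun k => (fine (mu A))^-1 *
    \int[mu]_(x in A) indic_approx U k x); last first.
  by apply/funext => k; rewrite meanE//; exact: indic_approx_continuous.
apply: cvgM; first exact: cvg_cst.
apply: fine_cvg.
rewrite fineK; last by apply: fin_num_measure; exact: measurableI.
rewrite -integral_indic//.
have [] := @dominated_convergence _ _ R mu A mA
  (fun k x => (indic_approx U k x)%:E) (fun x => (\1_U x)%:E) (cst 1%E).
- move=> k; apply/measurable_EFinP; apply: continuous_borel_measurable.
  exact: indic_approx_continuous.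
- by apply/measurable_EFinP.
- apply: aeW => x _; apply: cvg_EFin; first exact: nearW.
  exact: indic_approx_cvg.
- apply: (@continuous_integrable mu A (fun=> 1)) => //; exact: continuousCf.
- apply: aeW => x k _; rewrite lee_fin ger0_norm ?indic_approx_ge0//.
  exact: indic_approx_le1.
by [].
Qed.

(** The two normalized restrictions agree on open sets by [mean_open_cvg], and the open sets are
    stable under intersection and generate the Borel sets. Letting the events differ as well as the
    measures serves both invariance and ergodicity. *)
Lemma mean_inj mu nu A B : measurable A -> measurable B ->
    0 < fine (mu A) -> 0 < fine (nu B) ->
    (forall g, continuous g -> mean mu A g = mean nu B g) ->
  forall C, measurable C -> (fine (mu A))^-1 * fine (mu (C `&` A)) =
                            (fine (nu B))^-1 * fine (nu (C `&` B)).
Proof.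
move=> mA mB A0 B0 AB.
have r0 r : 0 < r -> 0 <= r^-1 :> R by move=> ?; rewrite invr_ge0 ltW.
pose m1 := mscale (NngNum (r0 _ A0)) (mrestr mu mA).
pose m2 := mscale (NngNum (r0 _ B0)) (mrestr nu mB).
have m1E C : measurable C ->
    m1 C = ((fine (mu A))^-1 * fine (mu (C `&` A)))%:E.
  move=> mC; rewrite /m1/= /mscale/= /mrestr EFinM fineK//.
  by apply: fin_num_measure; exact: measurableI.
have m2E C : measurable C ->
    m2 C = ((fine (nu B))^-1 * fine (nu (C `&` B)))%:E.
  move=> mC; rewrite /m2/= /mscale/= /mrestr EFinM fineK//.
  by apply: fin_num_measure; exact: measurableI.
move=> C mC.
suff : m1 C = m2 C by rewrite m1E// m2E// => -[].
apply: (@measure_unique _ R (borel X) (@open X) (fun=> setT) _ _ _ _ m1 m2).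
- by [].
- by move=> U V; exact: openI.
- by move=> _; exact: openT.
- by apply/seteqP; split=> // x _; exists 0%N.
- move=> U oU; have mU : measurable (U : set (borel X)).
    exact: sub_sigma_algebra.
  apply: etrans (m1E _ mU) (etrans _ (esym (m2E _ mU))); congr EFin.
  have c1 := mean_open_cvg (mu := mu) mA oU.
  have c2 := mean_open_cvg (mu := nu) mB oU.
  have e : (fun k => mean mu A (indic_approx U k)) =
           (fun k => mean nu B (indic_approx U k)).
    by apply/funext => k; apply: AB; exact: indic_approx_continuous.
  by rewrite e in c1; exact: (cvg_unique _ c1 c2).
- move=> _; apply: (eq_ind_r (fun z => z < +oo)%E _ (m1E _ measurableT)).
  exact: ltry.
- by [].
Qed.

(** The functions [indic_approx U k] are competitors whose means tend to [mu U]. This one inequality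
    is all that the comparison of states below asks for. *)
Lemma mean_inner_val mu U : open U -> (mu U <= inner_val (mean mu setT) U)%E.
Proof.
move=> oU; have mU : measurable (U : set (borel X)) by exact: sub_sigma_algebra.
have sm : state (mean mu setT).
  by apply: mean_state => //; rewrite probability_setT.
have := mean_open_cvg (mu := mu) measurableT oU.
rewrite probability_setT/= invr1 mul1r setIT => c.
rewrite -[leLHS]fineK; last exact: fin_num_measure.
rewrite -[leRHS]fineK ?inner_val_fin// lee_fin.
rewrite -(cvg_lim (@Rhausdorff R) c); apply: limr_le.
  by apply/cvg_ex; eexists; exact: c.
apply: nearW => k; rewrite -lee_fin fineK ?inner_val_fin//.
by apply: inner_val_ge; exact: indic_approx_below.
Qed.

(** * Comparison of two states through their values on open sets *)

Section Layers.
Variables (L M : (X -> R) -> R) (sL : state L) (sM : state M).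
Hypothesis LM : forall U, open U -> (inner_val L U <= inner_val M U)%E.

(** Layer-cake argument: [f] is cut into [N] slices [fi i] of height [1/N], and [N * fi i] lies
    between the indicators of [U i.+1] and [U i]. Summing over the slices, the shift of index costs
    the mass of one open set, at most 1, hence [1/N] after division. *)
Lemma state_le_layers f n : continuous f -> (forall x, 0 <= f x <= 1) ->
  L f <= M f + n.+1%:R^-1.
Proof.
move=> cf f01; set N := n.+1; set r := N%:R^-1.
have N0 : 0 < N%:R :> R by rewrite ltr0n.
have Nr : N%:R * r = 1 by rewrite mulfV// gt_eqF.
have r0 : 0 < r by rewrite invr_gt0.
pose U i : set X := [set x | i%:R * r < f x].
pose s i x := Num.min (f x) (i%:R * r).
pose fi i x := s i.+1 x - s i x.
have cs i : continuous (s i) by apply: continuous_minf => //; exact: continuousCf.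
have cfi i : continuous (fi i) by exact: continuousBf.
have oU i : open (U i).
  by apply: open_comp (@open_gt R (i%:R * r)) => x _; exact: cf.
have rS i : i.+1%:R * r = i%:R * r + r by rewrite -natr1 mulrDl mul1r.
have fi0 i x : 0 <= fi i x.
  by rewrite subr_ge0 le_min ge_min lexx/= ge_min rS lerDl (ltW r0) !orbT.
have fi1 i x : fi i x <= r.
  rewrite lerBlDr /s rS; have [fx|fx] := leP (f x) (i%:R * r).
    by rewrite ge_min lerDr (ltW r0).
  by rewrite ge_min (addrC r) lexx orbT.
have up i : N%:R * L (fi i) <= fine (inner_val M (U i)).
  rewrite -lee_fin fineK ?inner_val_fin//; apply: le_trans (LM (oU i)).
  rewrite -(stateZ sL)//; apply: inner_val_ge; apply: belowP.
  - exact: continuousZf.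
  - move=> x; apply/andP; split; first by rewrite mulr_ge0 ?fi0 ?(ltW N0).
    by rewrite -[leRHS]Nr ler_pM2l.
  - move=> x /negP; rewrite -leNgt => fx.
    rewrite /fi /s rS !min_l ?subrr ?mulr0//.
    by rewrite (le_trans fx)// lerDl ltW.
have low i : fine (inner_val M (U i.+1)) <= N%:R * M (fi i).
  rewrite -lee_fin fineK ?inner_val_fin//; apply: ge_ereal_sup => _ [h Uh <-].
  rewrite lee_fin -(stateZ sM)//; apply: state_le => //; first by case: Uh.
    exact: continuousZf.
  move=> x; have [fx|fx] := ltP (i.+1%:R * r) (f x); last first.
    by rewrite (below_out Uh) ?mulr_ge0 ?(ltW N0)//= => /(le_lt_trans fx); rewrite ltxx.
  rewrite (le_trans (below_le1 x Uh))// /fi /s min_r ?(ltW fx)//.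
  rewrite min_r; first by rewrite rS addrAC subrr add0r Nr.
  by rewrite (le_trans _ (ltW fx))// rS lerDl ltW.
have sumfi x : \sum_(i < N) fi i x = f x.
  rewrite -(big_mkord xpredT (fun i => fi i x)) telescope_sumr//.
  by have /andP[f0 f1] := f01 x; rewrite /s Nr mul0r min_l// min_r// subr0.
have sumS K : state K -> K f = \sum_(i < N) K (fi i).
  by move=> sK; rewrite -(state_sum sK _ cfi); congr K; apply/funext => x; rewrite sumfi.
rewrite -(ler_pM2l N0) mulrDr Nr (sumS L)// (sumS M)// !mulr_sumr.
apply: (@le_trans _ _ (\sum_(i < N) fine (inner_val M (U i)))).
  exact: ler_sum.
(* The set [U 0] is split off and bounded by 1; each other [U i.+1] is charged to slice [i], and the
   top slice is dropped as nonnegative. *)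
rewrite big_ord_recl addrC lerD//.
  apply: (@le_trans _ _ (\sum_(i < n) N%:R * M (fi i))).
    by apply: ler_sum => i _; rewrite lift0; exact: low.
  rewrite big_ord_recr/= lerDl mulr_ge0 ?(ltW N0)//.
  by apply: state_ge0.
by rewrite -lee_fin fineK ?inner_val_fin ?inner_val_le1.
Qed.

Lemma state_le_inner_val f : continuous f -> L f <= M f.
Proof.
move=> cf; have [b b0 fb] := continuous_bound cf.
have c0 : 0 < (2 * b)^-1 by rewrite invr_gt0 mulr_gt0.
(* The affine map from [[-b, b]] to [[0, 1]] is applied to [f]; states commute with it. *)
rewrite -(ler_pM2l c0) -(lerD2r (2^-1)).
rewrite -[X in _ + X](state_cst sL) -[X in _ <= _ + X](state_cst sM).
rewrite -!state_lin//; try exact: continuousCf.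
set F := fun x => _.
apply/ler_addgt0Pr => e e0.
have [n _ /(_ n (leqnn _))/= ne] : \forall n \near \oo, n.+1%:R^-1 < e.
  exact: near_infty_natSinv_lt (PosNum e0).
apply: (le_trans (state_le_layers n _ _)); last by rewrite lerD2l ltW.
  by apply: continuous_lin => //; exact: continuousCf.
move=> x; rewrite /F; have := fb x; rewrite ler_norml => /andP[fb1 fb2].
have -> : (2 * b)^-1 * f x + 2^-1 = (f x + b) / (2 * b).
  by field; rewrite gt_eqF.
rewrite divr_ge0 ?mulr_ge0 ?(ltW b0)//=; last by rewrite -lerBlDr sub0r.
by rewrite ler_pdivrMr ?mulr_gt0// mul1r mulr_natl mulr2n lerD2r.
Qed.

(** The one-sided comparison also applies to [- f], which reverses it. *)
Lemma state_eq_inner_val f : continuous f -> L f = M f.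
Proof.
move=> cf; apply/eqP; rewrite eq_le state_le_inner_val//=.
rewrite -lerN2 -mulN1r -[leRHS]mulN1r -!stateZ//.
by apply: state_le_inner_val; exact: continuousZf.
Qed.

End Layers.

(** The mean of the constructed measure dominates [L] on open sets, which already forces equality on
    C(X); elsewhere both functionals vanish. *)
Theorem riesz_representation (L : (X -> R) -> R) : state L ->
  exists mu : probability (borel X) R, L = mean mu setT.
Proof.
move=> sL; have [mu muL] := riesz_open cX sL; exists mu; apply/funext => f.
have sm : state (mean mu setT).
  by apply: mean_state => //; rewrite probability_setT.
have [cf|ncf] := pselect (continuous f).
  apply: state_eq_inner_val => // U oU; rewrite -muL//.
  exact: mean_inner_val.
by case: sL sm => [L0 _ _ _] [m0 _ _ _]; rewrite L0// m0.
Qed.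

End Mean.

(** * Extreme points by minimal faces *)

Section Faces.
Context {R : realType} {I : choiceType}.
Notation space := {ptws I -> R}.
Implicit Types (p q : I -> R) (E : set space) (Psi : (I -> R) -> R) (c : R).

Definition comb c p q : I -> R := fun i => c * p i + (1 - c) * q i.

Definition affine_on (K : set space) Psi := forall p q c, K p -> K q ->
  0 <= c <= 1 -> Psi (comb c p q) = c * Psi p + (1 - c) * Psi q.

Lemma eval_continuous_ptws (i : I) : continuous ((fun p => p i) : space -> R).
Proof. exact: (@proj_continuous I (fun=> R) i). Qed.

Lemma hausdorff_ptws : hausdorff_space space.
Proof. by apply: hausdorff_product => _; exact: Rhausdorff. Qed.

Variable K : set space.
Hypothesis cK : compact K.

(** The nonempty closed extremal subsets of [K], as in the proof of the Krein-Milman theorem. *)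
Definition face E := [/\ E `<=` K, closed E, E !=set0 &
  forall p q c, K p -> K q -> 0 < c < 1 -> E (comb c p q) -> E p /\ E q].

Definition argmax E Psi : set space :=
  [set p | E p /\ forall q, E q -> Psi q <= Psi p].

(** Compactness provides a maximum, and a combination with both weights positive reaches it only if
    both endpoints do. *)
Lemma face_argmax E Psi : {within K, continuous (Psi : space -> R)} ->
  affine_on K Psi -> face E -> face (argmax E Psi).
Proof.
move=> cPsi aPsi [EK clE E0 Eface].
have cE : compact E by exact: (subclosed_compact clE cK EK).
have [m Em maxm] := compact_EVT_max E0 cE (continuous_subspaceW EK cPsi).
rewrite inE in Em.
have argmaxE : argmax E Psi = E `&` [set p | Psi m <= Psi p].
  apply/seteqP; split=> [p [Ep pmax]|p [Ep mp]]; first by split=> //; exact: pmax.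
  by split=> // q Eq; rewrite (le_trans _ mp)// maxm// inE.
split.
- by move=> p [/EK].
(* Continuity holds only relative to [K], so the superlevel set is traded for a closed [V] of the
   whole space with the same trace on [K]. *)
- have /continuous_closedP/(_ [set r | Psi m <= r] (@closed_ge R _)) := cPsi.
  move=> /closed_subspaceP[V clV VK].
  rewrite argmaxE (_ : _ `&` _ = E `&` V); first exact: closedI.
  have VP p : E p -> V p <-> Psi m <= Psi p.
    move=> /EK Kp; move/seteqP : VK => [VK1 VK2].
    by split=> [Vp|mp]; [have [] := VK1 p (conj Vp Kp)|
                         have [] := VK2 p (conj mp Kp)].
  by apply/seteqP; split=> p [Ep] /VP-/(_ Ep).
- by exists m; rewrite argmaxE; split=> //=.
- move=> p q c Kp Kq c01; rewrite argmaxE => -[Epq].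
  have [Ep Eq] := Eface _ _ _ Kp Kq c01 Epq; have /andP[c0 c1] := c01.
  rewrite /= aPsi ?(ltW c0) ?(ltW c1)// => mpq.
  have pm : Psi p <= Psi m by apply: maxm; rewrite inE.
  have qm : Psi q <= Psi m by apply: maxm; rewrite inE.
  split; split=> //=.
    rewrite -(ler_pM2l c0) -(lerD2r ((1 - c) * Psi m)) -mulrDl addrC subrK mul1r.
    by rewrite (le_trans mpq)// lerD2l ler_wpM2l// subr_ge0 ltW.
  have c10 : 0 < 1 - c by rewrite subr_gt0.
  rewrite -(ler_pM2l c10) -(lerD2l (c * Psi m)) -mulrDl addrC subrK mul1r.
  by rewrite (le_trans mpq)// lerD2r ler_wpM2l// ltW.
Qed.

(** Zorn's lemma is applied to the open sets removed from [E0], so that unions of chains replace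
    intersections of faces. *)
Lemma minimal_face E0 : face E0 -> exists E,
  [/\ face E, E `<=` E0 & forall E', face E' -> E' `<=` E -> E' = E].
Proof.
move=> fE0; have [E0K clE0 E0n E0face] := fE0.
pose P := [set U : set space | open U /\ face (E0 `\` U)].
have [F FP Ftot|U [[oU fU] maxU]] := @Zorn_bigcup space P.
  have [->|/set0P[U0 FU0]] := eqVneq F set0.
    by rewrite bigcup_set0; split; [exact: open0|rewrite setD0].
  have clD U : open U -> closed (E0 `\` U).
    by move=> oU; apply: closedI => //; exact: open_closedC.
  have oF : open (\bigcup_(U in F) U) by apply: bigcup_open => U /FP[].
  split=> //; split.
  - by move=> p [/E0K].
  - exact: clD.
  (* The faces of the chain form a filter base; a cluster point in [K] belongs to each of them since
     they are closed. *)
  - have FF : ProperFilter (filter_from F (fun U => E0 `\` U)).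
      apply: filter_from_proper; last by move=> U /FP[_ []].
      apply: filter_from_filter; first by exists U0.
      move=> U V FU FV; have [UV|VU] := Ftot _ _ FU FV.
        by exists V => // p [Ep Vp]; split; split=> // /UV.
      by exists U => // p [Ep Up]; split; split=> // /VU.
    have FK : filter_from F (fun U => E0 `\` U) K.
      by exists U0 => // p [/E0K].
    have [p [Kp clp]] : K `&` cluster (filter_from F (fun U => E0 `\` U)) !=set0.
      exact: cK.
    have pU U : F U -> (E0 `\` U) p.
      move=> FU; apply: (clD U); first by have [] := FP _ FU.
      by move=> B /clp; apply; exists U.
    exists p; split; first by have [] := pU _ FU0.
    by move=> [U FU Up]; have [] := pU _ FU.
  - move=> p q c Kp Kq c01 [Epq Fpq]; have [Ep Eq] := E0face _ _ _ Kp Kq c01 Epq.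
    have pqU U : F U -> (E0 `\` U) p /\ (E0 `\` U) q.
      move=> FU; have [_ [_ _ _ +]] := FP _ FU; apply; [exact: Kp|exact: Kq|exact: c01|].
      by split=> // Upq; apply: Fpq; exists U.
    by split; split=> // -[U FU Up]; have [[_ ?] [_ ?]] := pqU _ FU.
exists (E0 `\` U); split=> //.
move=> E' fE' E'U; have [E'K clE' _ _] := fE'.
(* Removing the complement of [E'] from [E0] leaves the face [E'], so maximality of [U] forbids this
   complement from being strictly larger. *)
have UE : ~ U `<` ~` E'.
  move=> /maxU; apply; split; first exact: closed_openC.
  rewrite (_ : _ `\` _ = E')//; apply/seteqP; split=> [p [_ /contrapT]//|p E'p].
  by split; [have [] := E'U _ E'p|exact].
apply/seteqP; split=> // p [Ep Up]; apply: contrapT => E'p; apply: UE.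
split; first by move=> q Uq /E'U[].
by move=> /(_ p E'p).
Qed.

(** A form of the Bauer maximum principle; the coordinates serve as continuous affine functionals
    separating points. *)
Lemma extreme_maximum Psi : K !=set0 ->
    {within K, continuous (Psi : space -> R)} -> affine_on K Psi ->
  exists p, [/\ K p, forall q, K q -> Psi q <= Psi p &
    forall q1 q2 c, K q1 -> K q2 -> 0 < c < 1 -> p = comb c q1 q2 -> q1 = q2].
Proof.
move=> K0 cPsi aPsi.
have fK : face K.
  split=> //; exact: (compact_closed hausdorff_ptws cK).
have [E [fE EM minE]] := minimal_face (face_argmax cPsi aPsi fK).
have single p q : E p -> E q -> p = q.
  move=> Ep Eq; apply/funext => i.
  have fi : face (argmax E (fun r => r i)).
    apply: face_argmax => //.
    by apply: continuous_subspaceT; exact: eval_continuous_ptws.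
  have Ei : argmax E (fun r => r i) = E by apply: minE => // r [].
  have [_ pmax] : argmax E (fun r => r i) p by rewrite Ei.
  have [_ qmax] : argmax E (fun r => r i) q by rewrite Ei.
  by apply/eqP; rewrite eq_le pmax// qmax.
have [_ _ [p Ep] Eface] := fE; have [Kp pmax] := EM _ Ep.
exists p; split=> // q1 q2 c K1 K2 c01 pE; rewrite pE in Ep.
by have [E1 E2] := Eface _ _ _ K1 K2 c01 Ep; exact: single.
Qed.

End Faces.

(** * Invariant states *)

Section InvariantStates.
Context {R : realType} {X : pseudoPMetricType R}.
Hypothesis cX : compact [set: X].
Variable T : X -> X.
Hypothesis cT : continuous T.
Implicit Types (f g h : X -> R) (A B C : set (borel X)).
Implicit Types (mu nu : probability (borel X) R) (L M : (X -> R) -> R).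
Notation space := {ptws (X -> R) -> R}.

Lemma continuous_compT g : continuous g -> continuous (g \o T).
Proof. by move=> cg x; apply: continuous_comp; [exact: cT|exact: cg]. Qed.

(** Each instance of a clause of [state] is a closed condition on finitely many evaluations, hence
    survives pointwise limits. Filters are used because they describe closures in the product
    space. *)
Lemma state_lim (F : set_system space) (p : space) : ProperFilter F ->
  (\forall L \near F, state L) -> F --> p -> state p.
Proof.
move=> FF sF Fp.
have ev h : (fun L : space => L h) @ F --> p h.
  exact: (cvg_comp _ _ Fp (@eval_continuous_ptws R (X -> R) h p)).
have evN (u : space -> R) r : (\forall L \near F, u L = r) -> u @ F --> r.
  by move=> ur; apply: cvg_near_cst.
split.
- move=> g ncg; apply: (cvg_unique _ (ev g)) => //.
  by apply: evN; apply: filterS sF => L [+ _ _ _]; exact.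
- move=> a g h cg ch.
  have c1 : (fun L : space => L (fun x => a * g x + h x) - (a * L g + L h)) @ F -->
      p (fun x => a * g x + h x) - (a * p g + p h).
    apply: cvgB; first exact: ev.
    by apply: cvgD; [apply: cvgM; [exact: cvg_cst|exact: ev]|exact: ev].
  have c0 : (fun L : space => L (fun x => a * g x + h x) - (a * L g + L h)) @ F --> 0.
    by apply: evN; apply: filterS sF => L sL; rewrite state_lin// subrr.
  by apply/eqP; rewrite -subr_eq0; apply/eqP; exact: cvg_unique c1 c0.
- move=> g cg g0; rewrite -(cvg_lim (@Rhausdorff R) (ev g)).
  apply: limr_ge; first by apply/cvg_ex; eexists; exact: ev.
  by apply: filterS sF => L sL; exact: state_ge0.
- apply: (cvg_unique _ (ev _)) => //.
  by apply: evN; apply: filterS sF => L sL; exact: state1.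
Qed.

(** The Banach-Alaoglu argument: the states form a closed subset of a product of segments, compact
    by Tychonoff's theorem. *)
Lemma compact_states : compact [set L : space | state L].
Proof.
have [b Hb] : {b : (X -> R) -> R & forall g L, state L -> `|L g| <= b g}.
  apply: (@choice _ _ (fun g r => forall L, state L -> `|L g| <= r)) => g.
  have [cg|ncg] := pselect (continuous g); last first.
    by exists 0 => L [L0 _ _ _]; rewrite L0// normr0.
  have [M M0 gM] := continuous_bound cX cg.
  by exists M => L sL; exact: state_norm_le.
pose box := [set L : space | forall g, `[- b g, b g]%classic (L g)].
have cbox : compact box.
  exact: (@tychonoff (X -> R) (fun=> R) (fun g => `[- b g, b g]%classic)
    (fun g => @segment_compact R _ _)).
apply: (subclosed_compact _ cbox); last first.
  by move=> L sL g /=; rewrite in_itv/= -ler_norml; exact: Hb.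
move=> p; rewrite closureEcvg => -[F FF [Fp FS]].
by apply: (state_lim FF _ Fp); exact: FS.
Qed.

Definition inv_state : set space :=
  [set L | state L /\ forall g, continuous g -> L (g \o T) = L g].

Lemma compact_inv_state : compact inv_state.
Proof.
apply: (subclosed_compact _ compact_states); last by move=> L [].
move=> p; rewrite closureEcvg => -[F FF [Fp FS]]; split.
  apply: (state_lim FF _ Fp); apply: FS => L; by case.
move=> g cg; apply/eqP; rewrite -subr_eq0; apply/eqP.
have ev h : (fun L : space => L h) @ F --> p h.
  exact: (cvg_comp _ _ Fp (@eval_continuous_ptws R (X -> R) h p)).
apply: (cvg_unique _ (cvgB (ev _) (ev _))) => //.
apply: cvg_near_cst; apply: FS => L [_ LT]; rewrite fctE LT// subrr//.
Qed.

(** The Krylov-Bogolyubov argument along the orbit of one point. *)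
Lemma inv_state_nonempty : inv_state !=set0.
Proof.
pose x0 : X := point.
(* Averaging [n.+1] points makes [avg n] a state for every [n], including 0. *)
pose avg n : space := fun g =>
  if `[< continuous g >] then n.+1%:R^-1 * birkhoff T n.+1 g x0 else 0.
have avgE n g : continuous g -> avg n g = n.+1%:R^-1 * birkhoff T n.+1 g x0.
  by move=> cg; rewrite /avg; case: asboolP.
have savg n : state (avg n).
  split.
  - by move=> g ncg; rewrite /avg; case: asboolP.
  - move=> a g h cg ch; rewrite !avgE//; last exact: continuous_lin.
    by rewrite /birkhoff big_split/= -mulr_sumr; ring.
  - move=> g cg g0; rewrite avgE// mulr_ge0//.
    by apply: sumr_ge0.
  - rewrite avgE; last exact: continuousCf.
    by rewrite /birkhoff sumr_const card_ord mulVf// pnatr_eq0.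
have PF : ProperFilter (avg @ \oo) by exact: fmap_proper_filter.
(* A finer ultrafilter takes the place of a convergent subsequence. *)
have [G [UG sG]] := ultraFilterLemma PF.
have GS : G [set L : space | state L].
  by apply: sG; exists 0%N => // n _; exact: savg.
have := compact_states; rewrite compact_ultra => /(_ G UG GS)[p [sp Gp]].
exists p; split=> // g cg; apply/eqP; rewrite -subr_eq0; apply/eqP.
have ev h : (fun L : space => L h) @ G --> p h.
  exact: (cvg_comp _ _ Gp (@eval_continuous_ptws R (X -> R) h p)).
apply: (cvg_unique _ (cvgB (ev _) (ev _))) => //.
suff c0 : (fun n => avg n (g \o T) - avg n g) @ \oo --> 0.
  by move=> U /c0; exact: (sG ((fun L : space => L (g \o T) - L g) @^-1` U)).
have [b b0 gb] := continuous_bound cX cg.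
apply/cvgr0Pnorm_le => e e0; near=> n.
rewrite !avgE//; last exact: continuous_compT.
(* The two Birkhoff sums share all but their end terms, so the averages differ by at most
   [2 * b / n.+1]. *)
rewrite -mulrBr /birkhoff big_ord_recr/= [X in _ * (_ - X)]big_ord_recl/=.
have -> : \sum_(i < n) g (T (iter i T x0)) = \sum_(i < n) g (iter (bump 0 i) T x0).
  by apply: eq_bigr.
set S := \sum_(i < n) _; set y := g (T _); set z := g x0.
have -> : S + y - (z + S) = y - z by ring.
rewrite normrM ger0_norm// mulrC ler_pdivrMr//.
apply: (@le_trans _ _ (2 * b)).
  by rewrite (le_trans (ler_normB _ _))// mulr_natl mulr2n lerD// ?gb.
rewrite -ler_pdivrMl//.
near: n; have [N _ HN] := nbhs_infty_ger (e^-1 * (2 * b)).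
by exists N => // n /= Nn; rewrite (le_trans (HN n Nn))// ler_nat.
Unshelve. all: by end_near. Qed.

End InvariantStates.

(** * Invariant measures and asymptotic averages *)

Section InvariantMeasures.
Context {R : realType} {X : pseudoPMetricType R}.
Hypothesis cX : compact [set: X].
Variable T : X -> X.
Hypothesis cT : continuous T.
Implicit Types (f g h : X -> R) (A B C : set (borel X)).
Implicit Types (mu nu : probability (borel X) R) (L M : (X -> R) -> R).
Notation space := {ptws (X -> R) -> R}.

Lemma measurable_dynamics : measurable_fun setT (T : borel X -> borel X).
Proof.
apply: (@measurability _ _ (borel X) (borel X) setT T (@open X)) => // _ [U oU <-].
rewrite setTI; apply: sub_sigma_algebra.
by apply: open_comp => // x _; exact: cT.
Qed.

Lemma measurable_preimage_dynamics A : measurable A ->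
  measurable (T @^-1` A : set (borel X)).
Proof. by move=> mA; rewrite -[X in measurable X]setTI; exact: measurable_dynamics. Qed.

Definition push mu : probability (borel X) R :=
  distribution mu (MeasurableFun.Pack (MeasurableFun.Class
    (isMeasurableFun.Build _ _ _ _ _ measurable_dynamics))).

Lemma pushE mu A : push mu A = mu (T @^-1` A).
Proof. by []. Qed.

Lemma mean_push mu A g : measurable A -> continuous g ->
  mean (push mu) A g = mean mu (T @^-1` A) (g \o T).
Proof.
move=> mA cg; rewrite !meanE//; last exact: continuous_compT.
congr (_ * fine _); rewrite integral_pushforward//.
- by apply/measurable_EFinP; exact: continuous_borel_measurable.
- apply: (@continuous_integrable _ _ cX mu _ (g \o T)).
    by apply: measurable_preimage_dynamics.
  exact: continuous_compT.
Qed.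

(** Change of variables turns the mean of [g \o T] over the preimage of [A], which is [A], into the
    mean of [g] for the pushforward, which agrees with [mu] on measurable sets. *)
Lemma mean_inv_state mu A : Defs.invariant T mu -> measurable A -> T @^-1` A = A ->
  0 < fine (mu A) -> inv_state T (mean mu A).
Proof.
move=> Tmu mA TA A0; split; first exact: mean_state.
move=> g cg; rewrite -{1}TA -mean_push// !meanE//.
rewrite pushE TA; congr (_ * fine _).
by apply: eq_measure_integral => B mB _; exact: Tmu.
Qed.

Lemma fine_probT mu : 0 < fine (mu setT).
Proof. by rewrite probability_setT. Qed.

Lemma meanT_inv_state mu : Defs.invariant T mu -> inv_state T (mean mu setT).
Proof. by move=> Tmu; apply: mean_inv_state => //; exact: fine_probT. Qed.

(** For the representing measure, invariance on C(X) says that [mu] and its pushforward have the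
    same means, and [mean_inj] carries this to measurable sets. *)
Lemma inv_state_mean L : inv_state T L ->
  exists2 mu, Defs.invariant T mu & L = mean mu setT.
Proof.
move=> [sL LT]; have [mu Lmu] := riesz_representation cX sL.
exists mu => // A mA.
have /(_ A mA) : forall C, measurable C ->
    (fine (push mu setT))^-1 * fine (push mu (C `&` setT)) =
    (fine (mu setT))^-1 * fine (mu (C `&` setT)).
  apply: mean_inj => //; try exact: fine_probT.
  by move=> g cg; rewrite mean_push// preimage_setT -Lmu LT.
rewrite !probability_setT/= !invr1 !mul1r !setIT pushE => e.
have mTA : measurable (T @^-1` A : set (borel X)).
  by apply: measurable_preimage_dynamics.
by rewrite -[LHS]fineK ?fin_num_measure// e fineK ?fin_num_measure.
Qed.

Lemma extreme_ergodic mu : Defs.invariant T mu ->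
    (forall L M c, inv_state T L -> inv_state T M -> 0 < c < 1 ->
      mean mu setT = comb c L M -> L = M) ->
  ergodic T mu.
Proof.
move=> Tmu extr; split=> // A mA TA.
have mu01 : (0 <= mu A <= 1)%E by rewrite measure_ge0 probability_le1.
have finA : mu A \is a fin_num by exact: fin_num_measure.
have [a0|a0] := eqVneq (fine (mu A)) 0; first by left; rewrite -[LHS]fineK// a0.
have [a1|a1] := eqVneq (fine (mu A)) 1; first by right; rewrite -[LHS]fineK// a1.
exfalso.
set a := fine (mu A) in a0 a1.
have {}a0 : 0 < a by rewrite lt_neqAle eq_sym a0 fine_ge0//; case/andP: mu01.
have {}a1 : a < 1.
  by rewrite lt_neqAle a1 -lee_fin /a fineK//; case/andP: mu01.
have mCA : measurable (~` A) by exact: measurableC.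
have aC : fine (mu (~` A)) = 1 - a.
  by rewrite probability_setC// fineB// fineK.
have sA : inv_state T (mean mu A) by exact: mean_inv_state.
have sCA : inv_state T (mean mu (~` A)).
  apply: mean_inv_state => //; first exact: (congr1 setC TA).
  by rewrite aC subr_gt0.
have dec : mean mu setT = comb a (mean mu A) (mean mu (~` A)).
  apply/funext => g; rewrite /comb; have [cg|ncg] := pselect (continuous g).
    rewrite !meanE// aC mulrA mulfV ?gt_eqF// mul1r mulrA.
    rewrite mulfV ?gt_eqF ?subr_gt0// mul1r probability_setT/= invr1 mul1r.
    rewrite -(setUv A) Rintegral_setU//; last by apply/disj_setPCl.
    by rewrite setUv; exact: continuous_integrable.
  by rewrite /mean; case: asboolP => // _; rewrite !mulr0 addr0.
have AC : mean mu A = mean mu (~` A).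
  by apply: (extr _ _ a) => //; rewrite a0.
have AT : mean mu A = mean mu setT.
  by apply/funext => g; rewrite dec /comb -AC; ring.
(* Conditioning on [A] does not change the mean; testing the event [A] itself gives [1 = mu A]. *)
have /(_ A mA) : forall C, measurable C ->
    (fine (mu A))^-1 * fine (mu (C `&` A)) =
    (fine (mu setT))^-1 * fine (mu (C `&` setT)).
  by apply: mean_inj => //; [exact: fine_probT|move=> g cg; rewrite AT].
rewrite setIid setIT probability_setT/= invr1 mul1r -/a mulVf ?gt_eqF// => a1'.
by rewrite a1' ltxx in a1.
Qed.

End InvariantMeasures.

(** * Asymptotic averages of a potential on invariant states *)

Section AsymptoticAverages.
Context {R : realType} {X : pseudoPMetricType R}.
Hypothesis cX : compact [set: X].
Variable T : X -> X.
Hypothesis cT : continuous T.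
Variable fs : nat -> X -> R.
Hypothesis aF : AAP T fs.
Implicit Types (f g h : X -> R) (L M : (X -> R) -> R).
Notation space := {ptws (X -> R) -> R}.

(** The analogue of [Fstar] for functionals; [limn] is a genuine limit here only once [cvg_rate]
    gives convergence. *)
Definition rate (us : nat -> X -> R) L : R := limn (fun n => n%:R^-1 * L (us n)).

Lemma continuous_birkhoff g n : continuous g -> continuous (birkhoff T n g).
Proof.
move=> cg; apply: (continuous_sumf (gs := fun i x => g (iter i T x))) => i.
elim: i g cg => [|i IH] g cg //=.
rewrite (_ : (fun x => _) = (fun x => (g \o T) (iter i T x)))//.
by apply: IH; exact: continuous_compT.
Qed.

Lemma inv_state_birkhoff L g n : inv_state T L -> continuous g ->
  L (birkhoff T n g) = n%:R * L g.
Proof.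
move=> [sL LT] cg.
have it i : continuous (fun x => g (iter i T x)) /\ L (fun x => g (iter i T x)) = L g.
  elim: i => [//|i [ci Li]].
  have -> : (fun x => g (iter i.+1 T x)) = (fun x => g (iter i T x)) \o T.
    by apply/funext => x /=; rewrite -iterSr.
  by rewrite LT//; split=> //; exact: continuous_compT.
rewrite /birkhoff (state_sum sL _ (gs := fun i x => g (iter i T x))); last first.
  by move=> i; case: (it i).
under eq_bigr do rewrite (it _).2.
by rewrite sumr_const card_ord mulr_natl.
Qed.

(** Compactness bounds the range, so that [sup] is a true supremum and not a default value. *)
Lemma supnorm_ge g x : continuous g -> `|g x| <= supnorm g.
Proof.
move=> cg; apply: ub_le_sup; last by exists x.
by have [M M0 gM] := continuous_bound cX cg; exists M => _ [y _ <-].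
Qed.

(** An invariant state sends the Birkhoff sum of [g] to [n * L g], so the sup-norm bound passes to
    [L], with a rank that is the same for all invariant states. *)
Lemma AAP_approx xi : 0 < xi -> exists g, continuous g /\
  \forall n \near \oo, forall L, inv_state T L ->
    `|n%:R^-1 * L (fs n) - L g| <= xi.
Proof.
move=> xi0; have [cf /(_ xi xi0)[g [cg]]] := aF.
(* The upper limit is an infimum of suprema over neighbourhoods of infinity; one of them, [V],
   already has supremum below [xi]. *)
move=> /ereal_inf_lt[_ [V [N _ NV] <-] Vxi].
exists g; split=> //; near=> n => L iL; have [sL _] := iL.
have n0 : 0 < n%:R :> R by rewrite ltr0n; near: n; exact: nbhs_infty_gt.
have bn : (n%:R)^-1 * supnorm (fun x => fs n x - birkhoff T n g x) < xi.
  rewrite -lte_fin; apply: le_lt_trans Vxi; apply: ereal_sup_ubound.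
  by exists n => //; apply: NV; near: n; exact: nbhs_infty_ge.
have cd : continuous (fun x => fs n x - birkhoff T n g x).
  by apply: continuousBf => //; exact: continuous_birkhoff.
have -> : n%:R^-1 * L (fs n) - L g =
    n%:R^-1 * L (fun x => fs n x - birkhoff T n g x).
  rewrite stateB//; last exact: continuous_birkhoff.
  by rewrite inv_state_birkhoff// mulrBr mulKf// gt_eqF.
rewrite normrM ger0_norm ?invr_ge0 ?ler0n//; apply: le_trans (ltW bn).
rewrite ler_pM2l ?invr_gt0//; apply: state_norm_le => // x.
exact: supnorm_ge.
Unshelve. all: by end_near. Qed.

(** For every [e] the terms are eventually within [e / 2] of a single number [L g], so the sequence
    is Cauchy. *)
Lemma cvg_rate L : inv_state T L ->
  (fun n => n%:R^-1 * L (fs n)) @ \oo --> rate fs L.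
Proof.
move=> iL; apply: cauchy_cvg; apply: cauchy_exP => e e0.
have e20 : 0 < e / 2 by rewrite divr_gt0.
have [g [cg Hg]] := AAP_approx e20.
exists (L g); apply: filterS Hg => n /(_ L iL) H.
by rewrite /ball/= distrC (le_lt_trans H)// ltr_pdivrMr// ltr_pMr// ltr1n.
Qed.

Lemma rate_approx xi : 0 < xi -> exists g, continuous g /\
  forall L, inv_state T L -> `|rate fs L - L g| <= xi.
Proof.
move=> xi0; have [g [cg Hg]] := AAP_approx xi0; exists g; split=> // L iL.
have c : (fun n => `|n%:R^-1 * L (fs n) - L g|) @ \oo --> `|rate fs L - L g|.
  by apply: cvg_norm; apply: cvgB; [exact: cvg_rate|exact: cvg_cst].
rewrite -(cvg_lim (@Rhausdorff R) c); apply: limr_le.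
  by apply/cvg_ex; eexists; exact: c.
by apply: filterS Hg => n; exact.
Qed.

Lemma inv_state_comb L M c : inv_state T L -> inv_state T M -> 0 <= c <= 1 ->
  inv_state T (comb c L M).
Proof.
move=> [[L0 Ll Lp L1] LT] [[M0 Ml Mp M1] MT] /andP[c0 c1].
split; last by move=> g cg; rewrite /comb LT// MT.
rewrite /comb; split.
- by move=> g ncg; rewrite L0// M0// !mulr0 addr0.
- by move=> a g h cg ch; rewrite Ll// Ml//; ring.
- by move=> g cg g0; rewrite addr_ge0// mulr_ge0 ?subr_ge0 ?Lp ?Mp.
- by rewrite L1 M1; ring.
Qed.

Lemma affine_rate : affine_on (inv_state T) (rate fs).
Proof.
move=> L M c iL iM c01; have iC := inv_state_comb iL iM c01.
apply: (cvg_unique _ (cvg_rate iC)) => //.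
rewrite (_ : (fun n => _) = fun n => c * (n%:R^-1 * L (fs n)) +
    (1 - c) * (n%:R^-1 * M (fs n))); last by apply/funext => n; rewrite /comb; ring.
by apply: cvgD; apply: cvgM; try exact: cvg_cst; exact: cvg_rate.
Qed.

(** An [e / 3] argument: [rate_approx] is uniform in the state, and evaluation at [g] is
    continuous. *)
Lemma continuous_rate : {within inv_state T, continuous (rate fs : space -> R)}.
Proof.
apply/subspace_continuousP => L iL.
apply/cvgrPdist_le => e e0.
have e30 : 0 < e / 3 by rewrite divr_gt0.
have [g [cg Hg]] := rate_approx e30.
have Lg : \forall M \near (L : space), `|L g - M g| <= e / 3.
  by have /cvgrPdist_le/(_ _ e30) := @eval_continuous_ptws R (X -> R) g L.
rewrite near_withinE; near=> M => iM.
have LMg : `|L g - M g| <= e / 3 by near: M.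
have -> : rate fs L - rate fs M =
    (rate fs L - L g) + (L g - M g) - (rate fs M - M g) by ring.
rewrite (le_trans (ler_normB _ _))// (_ : e = e / 3 + e / 3 + e / 3); last by field.
by rewrite lerD ?Hg// (le_trans (ler_normD _ _))// lerD ?Hg.
Unshelve. all: by end_near. Qed.

Lemma Fstar_rate (mu : probability (borel X) R) : Fstar fs mu = rate fs (mean mu setT).
Proof.
rewrite /Fstar /rate; congr (limn _); apply/funext => n.
by rewrite meanT//; case: aF.
Qed.

End AsymptoticAverages.

(** * The constrained spectrum *)

Lemma convex_between (R : realFieldType) (x a y : R) :
  (x <= a <= y) || (y <= a <= x) ->
  exists c, 0 <= c <= 1 /\ c * x + (1 - c) * y = a.
Proof.
wlog xy : x y / x <= y => [wl|].
  have [xy|/ltW yx] := leP x y; first exact: wl.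
  rewrite orbC => /(wl _ _ yx)[c [/andP[c0 c1] <-]].
  exists (1 - c); split; last by ring.
  by rewrite subr_ge0 c1 lerBlDr lerDl.
move=> axy; have {axy} /andP[xa ay] : x <= a <= y.
  case/orP: axy => [//|/andP[ya ax]].
  by rewrite (le_trans xy ya) (le_trans ax xy).
(* Equal endpoints are set aside because the barycentric weight divides by [y - x]. *)
move: xy; rewrite le_eqVlt => /predU1P[xy|xy].
  exists 1; split; first by rewrite ler01 lexx.
  by apply/eqP; rewrite eq_le subrr mul0r mul1r addr0 xa xy ay.
have xy0 : 0 < y - x by rewrite subr_gt0.
exists ((y - a) / (y - x)); split.
  by rewrite divr_ge0 ?subr_ge0 ?(ltW xy)//= ler_pdivrMr// mul1r lerD2l lerN2.
by field; rewrite gt_eqF.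
Qed.

Section Spectrum.
Context {R : realType} {X : pseudoPMetricType R}.
Hypothesis cX : compact [set: X].
Variable T : X -> X.
Hypothesis cT : continuous T.
Implicit Types (L M : (X -> R) -> R) (fs phis : nat -> X -> R).
Implicit Types (mu : probability (borel X) R).

(** The dictionary between measures and states, by Riesz representation. The predicates [P] and [Q]
    cover the unconstrained extrema and the level sets at once. *)
Lemma Fstar_range fs (P : set (probability (borel X) R))
    (Q : set ((X -> R) -> R)) : AAP T fs ->
    (forall mu, Defs.invariant T mu -> P mu <-> Q (mean mu setT)) ->
  [set Fstar fs mu | mu in [set mu | Defs.invariant T mu /\ P mu]] =
  [set rate fs L | L in [set L | inv_state T L /\ Q L]].
Proof.
move=> aF PQ; apply/seteqP; split=> [_ [mu [Tmu /PQ-/(_ Tmu) Qmu] <-]|_ [L [iL QL] <-]].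
  exists (mean mu setT); last by rewrite (Fstar_rate aF).
  by split=> //; exact: meanT_inv_state.
have [mu Tmu Lmu] := inv_state_mean cX cT iL.
exists mu; last by rewrite (Fstar_rate aF) -Lmu.
by split=> //; apply/PQ => //; rewrite -Lmu.
Qed.

Lemma Fstar_rangeT fs : AAP T fs ->
  [set Fstar fs mu | mu in [set mu | Defs.invariant T mu]] =
  [set rate fs L | L in inv_state T].
Proof.
move=> aF; have := @Fstar_range fs setT setT aF (fun _ _ => conj id id).
rewrite (_ : [set mu | _ /\ _] = [set mu | Defs.invariant T mu]); last first.
  by apply/seteqP; split=> [mu []|mu].
rewrite (_ : [set L | _ /\ _] = inv_state T)//.
by apply/seteqP; split=> [L []|L].
Qed.

Lemma LambdaF_rate fs phis a : AAP T fs -> AAP T phis ->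
  LambdaF T fs phis a =
  sup [set rate fs L | L in [set L | inv_state T L /\ rate phis L = a]].
Proof.
move=> aF aPhi; congr sup; apply: Fstar_range => // mu _ /=.
by rewrite (Fstar_rate aPhi).
Qed.

Lemma rate_max fs : AAP T fs -> exists2 p, inv_state T p &
  forall q, inv_state T q -> rate fs q <= rate fs p.
Proof.
move=> aF; have [p] := compact_EVT_max (inv_state_nonempty cX cT)
  (@compact_inv_state R X cX T) (continuous_rate cX cT aF).
rewrite inE => ip pmax; exists p => // q iq; apply: pmax; exact/mem_set.
Qed.

Lemma rate_min fs : AAP T fs -> exists2 p, inv_state T p &
  forall q, inv_state T q -> rate fs p <= rate fs q.
Proof.
move=> aF; have [p] := compact_EVT_min (inv_state_nonempty cX cT)
  (@compact_inv_state R X cX T) (continuous_rate cX cT aF).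
rewrite inE => ip pmin; exists p => // q iq; apply: pmin; exact/mem_set.
Qed.

Lemma betaF_rate fs p : AAP T fs -> inv_state T p ->
  (forall q, inv_state T q -> rate fs q <= rate fs p) -> betaF T fs = rate fs p.
Proof.
move=> aF ip pmax; rewrite /betaF Fstar_rangeT//.
have ub : ubound [set rate fs L | L in inv_state T] (rate fs p).
  by move=> _ [q iq <-]; exact: pmax.
apply/eqP; rewrite eq_le ge_sup//=; last by exists (rate fs p), p.
by apply: ub_le_sup; [exists (rate fs p)|exists p].
Qed.

Lemma etaF_rate fs p : AAP T fs -> inv_state T p ->
  (forall q, inv_state T q -> rate fs p <= rate fs q) -> etaF T fs = rate fs p.
Proof.
move=> aF ip pmin; rewrite /etaF Fstar_rangeT//.
have lb : lbound [set rate fs L | L in inv_state T] (rate fs p).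
  by move=> _ [q iq <-]; exact: pmin.
apply/eqP; rewrite eq_le lb_le_inf//= ?andbT; last by exists (rate fs p), p.
by apply: ge_inf; [exists (rate fs p)|exists p].
Qed.

Section Monotonicity.
Variables (fs phis : nat -> X -> R) (aF : AAP T fs) (aPhi : AAP T phis).
Variable M : (X -> R) -> R.
Hypotheses (iM : inv_state T M)
  (maxM : forall L, inv_state T L -> rate fs L <= rate fs M).

Lemma rate_between L a : inv_state T L ->
    (rate phis L <= a <= rate phis M) || (rate phis M <= a <= rate phis L) ->
  exists c, [/\ 0 <= c <= 1, inv_state T (comb c L M) &
    rate phis (comb c L M) = a].
Proof.
move=> iL /convex_between[c [c01 ca]]; exists c; split=> //.
  exact: inv_state_comb.
by rewrite (affine_rate cX cT aPhi).
Qed.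

(** Each [N] at level [a] is moved along the segment towards the maximizer [M] until it reaches
    level [b]; [rate fs] is affine there and cannot fall below its value at [N]. The disjunctions
    treat both sides of the level of [M]. *)
Lemma LambdaF_le a b L : inv_state T L ->
    (rate phis L <= a <= rate phis M) || (rate phis M <= a <= rate phis L) ->
    (a <= b <= rate phis M) || (rate phis M <= b <= a) ->
  LambdaF T fs phis a <= LambdaF T fs phis b.
Proof.
move=> iL aL bM; rewrite !LambdaF_rate//.
(* [L] ensures that level [a] is attained, so that the supremum on the left is not over the empty
   set. *)
have [c [_ iC rC]] := rate_between iL aL.
apply: ge_sup; first by exists (rate fs (comb c L M)), (comb c L M).
move=> _ [N [iN rN] <-]; rewrite -rN in bM.
have [d [d01 iD rD]] := rate_between iN bM.
apply: (@le_trans _ _ (rate fs (comb d N M))); last first.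
  (* The maximality of [M] bounds the values at level [b], as the supremum requires. *)
  apply: ub_le_sup; last by exists (comb d N M).
  by exists (rate fs M) => _ [? [? _] <-]; exact: maxM.
rewrite (affine_rate cX cT aF)//; have /andP[d0 d1] := d01.
rewrite -[leLHS]mul1r -{1}(subrK d 1) addrC mulrDl lerD2l.
by rewrite ler_wpM2l ?subr_ge0// maxM.
Qed.

End Monotonicity.
End Spectrum.

Theorem theoremB (R : realType) (X : pseudoPMetricType R)
  (hX : hausdorff_space X) (cX : compact [set: X])
  (T : X -> X) (cT : continuous T)
  (fs phis : nat -> X -> R) (hF : AAP T fs) (hPhi : AAP T phis) :
  (exists mu : probability (borel X) R, ergodic T mu /\ Fstar fs mu = betaF T fs) /\
  forall mustar : probability (borel X) R,
    ergodic T mustar -> Fstar fs mustar = betaF T fs ->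
    let alphastar := Fstar phis mustar in
    (forall a b : R, etaF T phis <= a -> a <= b -> b <= alphastar ->
       LambdaF T fs phis a <= LambdaF T fs phis b) /\
    (forall a b : R, alphastar <= a -> a <= b -> b <= betaF T phis ->
       LambdaF T fs phis b <= LambdaF T fs phis a).
Proof.
split.
  have [p [ip pmax pext]] := extreme_maximum (@compact_inv_state R X cX T)
    (inv_state_nonempty cX cT) (continuous_rate cX cT hF)
    (affine_rate cX cT hF).
  have [mu Tmu pE] := inv_state_mean cX cT ip; exists mu; split.
    apply: (extreme_ergodic cX cT) => // L M c iL iM c01 LM.
    by apply: (pext L M c) => //; rewrite pE.
  by rewrite (betaF_rate cX cT hF ip pmax) (Fstar_rate hF) -pE.
move=> mu [Tmu _]; have iM := meanT_inv_state cX cT Tmu.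
rewrite (Fstar_rate hF) (Fstar_rate hPhi) => muF /=.
(* The value [betaF] is attained at some [q], so equality with it makes the mean of [mu] a
   maximizer. *)
have maxM L : inv_state T L -> rate fs L <= rate fs (mean mu setT).
  have [q iq qmax] := rate_max cX cT hF.
  by rewrite muF (betaF_rate cX cT hF iq qmax); exact: qmax.
split=> a b.
  (* The minimizer [q] of the asymptotic average of [phis] is the far end of the segment showing
     that level [a] is attained; on the other side a maximizer does this. *)
  have [q iq qmin] := rate_min cX cT hPhi; rewrite (etaF_rate cX cT hPhi iq qmin) => qa ab bM.
  apply: (LambdaF_le cX cT hF hPhi iM maxM iq); last by rewrite ab bM.
  by rewrite qa (le_trans ab bM).
have [q iq qmax] := rate_max cX cT hPhi; rewrite (betaF_rate cX cT hPhi iq qmax) => Ma ab bq.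
apply: (LambdaF_le cX cT hF hPhi iM maxM iq); last by rewrite Ma ab orbT.
by rewrite bq (le_trans Ma ab) orbT.
Qed.
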